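(* Let $K\ge1$, let $(p_1,\dots,p_K)$ and $(q_1,\dots,q_K)$ be probability vectors, let $\Pi_1,\dots,\Pi_K$ be arbitrary probability distributions on $\mathcal{X}^1\times\mathcal{Y}$, and let $\alpha\in(0,1)$. Let $P$ be the distribution of $(X,Y)=(X^0,X^1,Y)$ given by $X^0\sim\textnormal{Multinomial}(p_1,\dots,p_K)$ and $(X^1,Y)\mid X^0=k\sim\Pi_k$, and let $Q$ be defined in the same way with $q_1,\dots,q_K$ in place of $p_1,\dots,p_K$. Suppose $(X_1,Y_1),\dots,(X_n,Y_n)$ are i.i.d. from $P$ and $(X_{n+1},Y_{n+1})$ is drawn from $Q$ independently of them. Let $s:\mathcal{X}\times\mathcal{Y}\to\mathbb{R}$ be any fixed measurable score function and let $\widehat{C}_n$ be the GWCP prediction set defined in the context, with $n_k=\sum_{i\le n}\mathbf{1}\{X_i^0=k\}$. Then \[\mathbb{P}\left\{Y_{n+1}\in\widehat{C}_n(X_{n+1})\right\}\ \ge\ 1-\alpha-\mathbb{E}\left[\max_{k:\,n_k>0}\{q_k/n_k\}\right].\] In particular, if $\min_k p_k\ge\frac{8\log n}{n}$, then \[\mathbb{P}\left\{Y_{n+1}\in\widehat{C}_n(X_{n+1})\right\}\ \ge\ 1-\alpha-4n^{-1}\max_k\{q_k/p_k\}.\]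
   Context: Features are $x=(x^0,x^1)\in\mathcal{X}=[K]\times\mathcal{X}^1$, where $x^0\in[K]=\{1,\dots,K\}$ is the group label. For a probability distribution $\mu$ on $\mathbb{R}\cup\{+\infty\}$ and $\tau\in(0,1]$, $\textnormal{Quantile}_{\tau}(\mu)=\inf\{t\in\mathbb{R}\cup\{+\infty\}:\mu([-\infty,t])\ge\tau\}$; $\delta_s$ denotes the point mass at $s$. Given calibration data, set $s_i=s(X_i,Y_i)$, $n_k=\sum_{i\le n}\mathbf{1}\{X_i^0=k\}$, and $\widehat{P}^{(k)}_{\textnormal{score}}=\frac{1}{n_k}\sum_{i\le n:\,X_i^0=k}\delta_{s_i}$ if $n_k>0$, while $\widehat{P}^{(k)}_{\textnormal{score}}=\delta_{+\infty}$ if $n_k=0$. The GWCP prediction set is $\widehat{C}_n(x)=\{y\in\mathcal{Y}: s(x,y)\le\widehat{q}\}$ with $\widehat{q}=\textnormal{Quantile}_{1-\alpha}\big(\sum_{k=1}^K q_k\widehat{P}^{(k)}_{\textnormal{score}}\big)$. *)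

(* Defs.v *)
From HB Require Import structures.
From mathcomp Require Import all_boot all_order all_algebra.
From mathcomp Require Import all_classical all_reals all_analysis.
Set Implicit Arguments. Unset Strict Implicit. Unset Printing Implicit Defensive.
Import Order.TTheory GRing.Theory Num.Theory.
Local Open Scope classical_set_scope.
Local Open Scope ring_scope.

(* Quantile_tau(mu) = inf { t in R u {+oo} : mu([-oo,t]) >= tau },
   where the distribution mu on R u {+oo} is given through its
   cumulative mass function  F t = mu([-oo, t]). *)
Definition quantile_of {R : realType} (tau : R) (F : \bar R -> R) : \bar R :=
  ereal_inf [set t : \bar R | t != -oo%E /\ tau <= F t].

Section GWCP.
Context {R : realType} {d : measure_display} {Omega : measurableType d}
  {X1 Y : Type} {n K : nat}.

(* index i : 'I_n of the calibration data, seen as an index of the n+1 points;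
   the test point (X_{n+1},Y_{n+1}) has index ord_max. *)
Definition cal (i : 'I_n) : 'I_n.+1 := widen_ord (leqnSn n) i.

Variables (G : 'I_n.+1 -> Omega -> 'I_K) (Z : 'I_n.+1 -> Omega -> (X1 * Y)%type)
  (s : ('I_K * X1)%type -> Y -> R).

Definition score (i : 'I_n.+1) (w : Omega) : R :=
  s (G i w, (Z i w).1) (Z i w).2.

Definition ncount (w : Omega) (k : 'I_K) : nat :=
  #|[set i : 'I_n | G (cal i) w == k]|.

(* t |-> \hat P^{(k)}_score([-oo, t]) : empirical score distribution of group k,
   or the point mass at +oo if n_k = 0 *)
Definition emp_cdf (w : Omega) (k : 'I_K) (t : \bar R) : R :=
  if (0 < ncount w k)%N then
    (ncount w k)%:R^-1 *
      \sum_(i : 'I_n | G (cal i) w == k) (((score (cal i) w)%:E <= t)%E)%:R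
  else (((+oo)%E <= t)%E)%:R.

Definition gwcp_qhat (q : 'I_K -> R) (alpha : R) (w : Omega) : \bar R :=
  quantile_of (1 - alpha) (fun t => \sum_(k : 'I_K) q k * emp_cdf w k t).

(* event { Y_{n+1} \in \hat C_n(X_{n+1}) } = { s(X_{n+1},Y_{n+1}) <= \hat q } *)
Definition covered (q : 'I_K -> R) (alpha : R) : set Omega :=
  [set w | ((score ord_max w)%:E <= gwcp_qhat q alpha w)%E].

(* max_{k : n_k > 0} q_k / n_k  (0 if no group is observed) *)
Definition max_ratio (q : 'I_K -> R) (w : Omega) : R :=
  \big[Num.max/0]_(k : 'I_K | (0 < ncount w k)%N) (q k / (ncount w k)%:R).

End GWCP.

(* Mutual independence of the n+1 random elements (X_i^0, (X_i^1, Y_i)),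
   i = 1..n+1, each valued in [K] x (X^1 x Y); the sigma-algebra of
   [K] x (X^1 x Y) is the product of the discrete one on [K] and the given
   one on X^1 x Y, tested here on its generating rectangles S x A. *)
Definition mutually_independent {R : realType} {d : measure_display}
  {Omega : measurableType d} {d' : measure_display} {T : measurableType d'}
  {I : finType} {K : nat}
  (P : probability Omega R) (G : I -> Omega -> 'I_K) (Z : I -> Omega -> T) :=
  forall (S : I -> set 'I_K) (A : I -> set T), (forall i, measurable (A i)) ->
    P (\bigcap_(i in [set: I]) (G i @^-1` S i `&` Z i @^-1` A i)) =
    (\prod_(i : I) P (G i @^-1` S i `&` Z i @^-1` A i))%E.

Definition has_group_mixture_law {R : realType} {d : measure_display}
  {Omega : measurableType d} {d' : measure_display} {T : measurableType d'}
  {K : nat} (P : probability Omega R) (G0 : Omega -> 'I_K) (Z0 : Omega -> T)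
  (p : 'I_K -> R) (Pi : 'I_K -> probability T R) :=
  forall (k : 'I_K) (A : set T), measurable A ->
    P (G0 @^-1` [set k] `&` Z0 @^-1` A) = ((p k)%:E * Pi k A)%E.

Definition prob_vector {R : realType} {K : nat} (p : 'I_K -> R) :=
  (forall k, 0 <= p k) /\ \sum_(k : 'I_K) p k = 1.

(* Main.v *)
(* Fix the groups h of the calibration points and the group k of the test point, and give
   calibration point j the weight c_j = q_(h j) / n_(h j). The test point is not covered iff the
   calibration scores strictly below its own score have total weight at least 1 - alpha. If n_k > 0,
   the test point may be exchanged with any calibration point of group k, because conditionally on
   the groups they have the same law; the exchange changes the weight below by at most
   m = max q_k / n_k. Averaging over the n_k points of the group and summing over k, the miscoverage
   is bounded by the mass that the weighted empirical distribution (including its atom at +oo, of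
   mass 1 - \sum_j c_j) gives to points with mass at least 1 - alpha - m strictly below them, and
   this is at most alpha + m for every sample.

   For the explicit rate, let M = max q_k / p_k. Either n_k >= n p_k / 3, and then
   q_k / n_k <= 3 M / n, or 1 <= e^(n p_k / 3) 2^(-n_k), whose right-hand side has expectation
   e^(n p_k / 3) (1 - p_k / 2)^n <= e^(- n p_k / 6) <= 1 / n. *)
Require Import Defs.
From HB Require Import structures.
From mathcomp Require Import all_boot all_order all_algebra fingroup perm.
From mathcomp Require Import all_classical all_reals all_analysis.
From mathcomp Require Import measurable_realfun.
From mathcomp Require Import ring lra.
Import Order.TTheory GRing.Theory Num.Theory.
Set Implicit Arguments. Unset Strict Implicit. Unset Printing Implicit Defensive.
Local Open Scope classical_set_scope.
Local Open Scope ring_scope.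

(** * Joint laws of tuples and rectangles *)

(** One-coordinate cylinders are rectangles with all other sides full, and rectangles are finite
    intersections of cylinders. Rectangles are closed under intersection, as uniqueness of measures
    requires. *)
Lemma measurable_tuple_rectangles {d : measure_display} (T : measurableType d)
    (n : nat) :
  @measurable _ (n.-tuple T) = <<s [set E : set (n.-tuple T) |
    exists2 B : 'I_n -> set T, (forall i, measurable (B i)) &
      E = [set x | forall i, B i (tnth x i)]] >>.
Proof.
rewrite eqEsubset; split; apply: smallest_sub.
- exact: smallest_sigma_algebra.
- move=> E; rewrite -bigcup_seq => -[i _ [A mA <-]].
  apply: sub_sigma_algebra; exists (fun j => if j == i then A else setT).
    by move=> j; case: ifP.
  rewrite setTI; apply/seteqP; split=> [x Ax j|x /(_ i)]; last by rewrite eqxx.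
  by case: eqP => [->|].
- exact: sigma_algebra_measurable.
- move=> E [B mB ->].
  rewrite [X in measurable X](_ : _ =
      \bigcap_(i in [set: 'I_n]) (@tnth n T ^~ i) @^-1` B i); last first.
    by apply/seteqP; split=> x xB i; [move=> _|]; exact: (xB i).
  apply: fin_bigcap_measurable => //= i _.
  by rewrite -[X in measurable X]setTI; exact: measurable_tnth.
Qed.

Lemma eq_measure_tuple {d : measure_display} (T : measurableType d) (n : nat)
    {R : realType} (m1 m2 : {measure set (n.-tuple T) -> \bar R}) :
  (m1 setT < +oo)%E ->
  (forall B : 'I_n -> set T, (forall i, measurable (B i)) ->
    m1 [set x | forall i, B i (tnth x i)] =
    m2 [set x | forall i, B i (tnth x i)]) ->
  forall E, measurable E -> m1 E = m2 E.
Proof.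
move=> m1oo m12; apply: (measure_unique _ (fun=> setT)
  (measurable_tuple_rectangles T n)) => //.
- move=> _ _ [B mB ->] [C mC ->]; exists (fun i => B i `&` C i).
    by move=> i; exact: measurableI.
  apply/seteqP; split=> [x [xB xC] i|x xBC]; first by split.
  by split=> i; case: (xBC i).
- by move=> _; exists (fun=> setT) => //; apply/seteqP; split.
- by apply/seteqP; split=> // x _; exists 0%N.
- by move=> _ [B mB ->]; exact: m12.
Qed.

(** Conditioning is expressed by intersecting with [D1] and [D2], which avoids dividing by
    probabilities that may vanish. With [c = 1] and permuted variables this gives exchangeability;
    with [c = q k] it gives independence of the test label from the calibration scores. *)
Lemma eq_joint_law {R : realType} {d d' : measure_display}
    {Omega : measurableType d} (T : measurableType d') (n : nat)
    (P : probability Omega R) (D1 D2 : set Omega) (V1 V2 : 'I_n -> Omega -> T)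
    (c : {nonneg R}) :
  measurable D1 -> measurable D2 ->
  (forall i, measurable_fun setT (V1 i)) ->
  (forall i, measurable_fun setT (V2 i)) ->
  (forall B : 'I_n -> set T, (forall i, measurable (B i)) ->
    P ([set w | forall i, B i (V1 i w)] `&` D1) =
    (c%:num%:E * P ([set w | forall i, B i (V2 i w)] `&` D2))%E) ->
  forall E : set (n.-tuple T), measurable E ->
    P ([set w | E [tuple V1 i w | i < n]] `&` D1) =
    (c%:num%:E * P ([set w | E [tuple V2 i w | i < n]] `&` D2))%E.
Proof.
move=> mD1 mD2 mV1 mV2 eqP12 E mE.
have mV V : (forall i, measurable_fun setT (V i)) ->
    measurable_fun setT (fun w : Omega => [tuple V i w | i < n] : n.-tuple T).
  move=> mV; apply/measurable_fun_tnthP => i.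
  by apply: eq_measurable_fun (mV i) => w _ /=; rewrite tnth_mktuple.
have := @eq_measure_tuple _ T n R (pushforward (mrestr P mD1) _)
  (mscale c (pushforward (mrestr P mD2) _)).
move=> /(_ _ (mV _ mV1) _ (mV _ mV2)); apply => //.
- apply: (@le_lt_trans _ _ 1%E); last exact: ltry.
  rewrite /= /pushforward /mrestr; apply: probability_le1.
  by rewrite preimage_setT setTI.
- move=> B mB; rewrite /= /mscale /= /pushforward /= /mrestr /=.
  rewrite [X in P (X `&` _)](_ : _ = [set w | forall i, B i (V1 i w)]).
    rewrite [X in P (X `&` D2)](_ : _ = [set w | forall i, B i (V2 i w)]).
      exact: eqP12.
    by apply/seteqP; split=> w wB i /=; have := wB i; rewrite /= tnth_mktuple.
  by apply/seteqP; split=> w wB i /=; have := wB i; rewrite /= tnth_mktuple.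
Qed.

(** * Weighted mass strictly below a point *)

Definition mass_below {R : realType} {n : nat} (c x : 'I_n -> R) (y : R) : R :=
  \sum_(j < n) c j * (x j < y)%R%:R.

Lemma mass_below_ext {R : realType} {n : nat} (c x y : 'I_n -> R) (z : R) :
  x =1 y -> mass_below c x z = mass_below c y z.
Proof. by move=> xy; apply: eq_bigr => j _; rewrite xy. Qed.

Lemma mass_below_le {R : realType} {n : nat} (c x : 'I_n -> R) (y : R) :
  (forall j, 0 <= c j) -> mass_below c x y <= \sum_j c j.
Proof.
move=> c0; apply: ler_sum => j _.
by case: (_ < _)%R; rewrite ?mulr1 ?mulr0.
Qed.

Lemma measurable_mass_below {R : realType} {d : measure_display}
    {Omega : measurableType d} {n : nat} (c : 'I_n -> R) (X : 'I_n -> Omega -> R)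
    (Y : Omega -> R) (b : R) :
  (forall j, measurable_fun setT (X j)) -> measurable_fun setT Y ->
  measurable [set w | b <= mass_below c (X^~ w) (Y w)].
Proof.
move=> mX mY; rewrite -[X in measurable X]setTI.
apply: measurable_fun_le => //; apply: measurable_sum => j.
apply: measurable_funM => //.
have := measurable_fun_ltr (mX j) mY.
exact: (measurableT_comp (f := fun b : bool => b%:R : R)).
Qed.

(* Only the points whose lower mass reaches [1 - alpha - m] contribute to the first sum; if [x i] is
   the smallest of them, they are disjoint from the points strictly below [x i], so their total
   weight is at most [\sum_j c j - (1 - alpha - m)]. *)
Lemma heavy_rank_mass_le {R : realType} (n : nat) (c x : 'I_n -> R) (alpha m : R) :
  (forall j, 0 <= c j) -> \sum_j c j <= 1 -> 0 <= alpha -> 0 <= m ->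
  \sum_i c i * (1 - alpha - m <= mass_below c x (x i))%R%:R
    + (1 - \sum_j c j) * (1 - alpha <= \sum_j c j)%R%:R <= alpha + m.
Proof.
move=> c0 c1 a0 m0; set b := 1 - alpha - m; set s := \sum_j c j.
have ind01 (B : bool) (z : R) : 0 <= z -> z * B%:R <= z.
  by case: B => z0; rewrite ?mulr1 ?mulr0.
have [[i0 bi0]|nobi] := pselect (exists i, b <= mass_below c x (x i)); last first.
  (* No point reaches the threshold: only the atom term remains, and it can be nonzero only if
     [1 - s <= alpha]. *)
  rewrite big1 ?add0r => [|i _]; last first.
    by case: (boolP (b <= _)) => [bi|]; [case: nobi; exists i|rewrite mulr0].
  by case: (boolP (1 - alpha <= s)) => cs; rewrite ?mulr1 ?mulr0; lra.
have [i bi imin] := Order.TotalTheory.arg_minP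
  (P := fun i => b <= mass_below c x (x i)) x bi0.
have : \sum_j c j * (b <= mass_below c x (x j))%R%:R + mass_below c x (x i) <= s.
  rewrite -big_split/=; apply: ler_sum => j _; rewrite -mulrDr.
  case: (boolP (b <= _)) => [/imin ij|_].
    by rewrite ltNge ij addr0 mulr1.
  by rewrite add0r; exact: ind01.
have : (1 - s) * (1 - alpha <= s)%R%:R <= 1 - s by apply: ind01; rewrite subr_ge0.
move: bi; rewrite /b /s; lra.
Qed.

(** Integrating over [D] turns an inequality valid for every sample into one between
    probabilities. *)
Lemma sum_measure_le {R : realType} {d : measure_display}
    {Omega : measurableType d} (P : probability Omega R) (I : finType)
    (c : I -> R) (E : I -> set Omega) (D : set Omega) (b : R) :
  measurable D -> (forall i, measurable (E i)) -> (forall i, 0 <= c i) ->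
  (forall w, D w -> \sum_i c i * \1_(E i) w <= b) ->
  (\sum_i (c i)%:E * P (E i `&` D) <= b%:E * P D)%E.
Proof.
move=> mD mE c0 Eb.
have mf i : measurable_fun D (fun w => (c i)%:E * (\1_(E i) w)%:E)%E.
  by apply/measurable_EFinP/measurable_funM => //; exact: measurable_indic.
rewrite -(integral_cst P mD b%:E).
rewrite (eq_bigr (fun i => \int[P]_(w in D) ((c i)%:E * (\1_(E i) w)%:E)))%E.
  rewrite -ge0_integral_sum//; last first.
    by move=> i w _; rewrite mule_ge0// lee_fin.
  apply: ge0_le_integral => //.
  - by move=> w _; apply: sume_ge0 => i _; rewrite mule_ge0// lee_fin.
  - exact: emeasurable_sum.
  - by move=> w Dw; rewrite sumEFin lee_fin; exact: Eb.
move=> i _; rewrite ge0_integralZl//; last by rewrite lee_fin.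
- by rewrite integral_indic.
- by apply/measurable_EFinP; exact: measurable_indic.
Qed.

(** * Fixed calibration labels and the resulting quantile *)

Definition group_count {n K : nat} (h : {ffun 'I_n -> 'I_K}) (k : 'I_K) : nat :=
  #|[pred i | h i == k]|.

(** The mass that point [j] contributes to the mixture of empirical distributions; the denominator
    is positive because [j] belongs to its own group. *)
Definition group_weight {R : realType} {n K : nat} (q : 'I_K -> R)
    (h : {ffun 'I_n -> 'I_K}) (j : 'I_n) : R :=
  q (h j) / (group_count h (h j))%:R.

Definition group_max {R : realType} {n K : nat} (q : 'I_K -> R)
    (h : {ffun 'I_n -> 'I_K}) : R :=
  \big[Num.max/0]_(k | (0 < group_count h k)%N) (q k / (group_count h k)%:R).

(** These finitely many events partition the sample space, and on each of them all counts and
    weights are constants. *)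
Definition config {d : measure_display} {T : measurableType d} {n K : nat}
    (G : 'I_n.+1 -> T -> 'I_K)
    (h : {ffun 'I_n -> 'I_K}) : set T :=
  [set w | forall j, G (cal j) w = h j].

Lemma ncount_config {d : measure_display} {T : measurableType d} {n K : nat}
    (G : 'I_n.+1 -> T -> 'I_K)
    (h : {ffun 'I_n -> 'I_K}) (w : T) (k : 'I_K) :
  config G h w -> ncount G w k = group_count h k.
Proof. move=> hw; apply: eq_card => i; rewrite [RHS]inE -hw.
by apply/idP/idP => [|?]; rewrite inE. Qed.

Lemma max_ratio_config {R : realType} {d : measure_display} {T : measurableType d} {n K : nat}
    (G : 'I_n.+1 -> T -> 'I_K) (q : 'I_K -> R) (h : {ffun 'I_n -> 'I_K}) (w : T) :
  config G h w -> max_ratio G q w = group_max q h.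
Proof.
move=> hw; apply: eq_big => k; rewrite (ncount_config k hw)//.
Qed.

Lemma sum_group_weight {R : realType} {n K : nat} (q : 'I_K -> R)
    (h : {ffun 'I_n -> 'I_K}) (f : 'I_n -> R) :
  \sum_j group_weight q h j * f j =
  \sum_(k | (0 < group_count h k)%N)
     q k * ((group_count h k)%:R^-1 * \sum_(j | h j == k) f j).
Proof.
rewrite (partition_big h (fun k => (0 < group_count h k)%N))/=; last first.
  by move=> j _; apply/card_gt0P; exists j; rewrite inE.
apply: eq_bigr => k _; rewrite mulrA mulr_sumr.
by apply: eq_bigr => j /eqP hj; rewrite /group_weight hj.
Qed.

Lemma sum_group_weight1 {R : realType} {n K : nat} (q : 'I_K -> R)
    (h : {ffun 'I_n -> 'I_K}) :
  \sum_j group_weight q h j = \sum_(k | (0 < group_count h k)%N) q k.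
Proof.
under eq_bigr do rewrite -[group_weight _ _ _]mulr1.
rewrite (sum_group_weight q h (fun=> 1)); apply: eq_bigr => k k0.
rewrite sumr_const.
by rewrite mulVf ?mulr1 // pnatr_eq0 -lt0n.
Qed.

(** A score exceeds the quantile iff some level [t] strictly below it already has cumulative mass
    [1 - alpha]. The cumulative mass is a step function, so the best such [t] is the largest
    calibration score below the test score. *)
Lemma uncovered_config {R : realType} {d : measure_display} {T : measurableType d}
    {X1 Y : Type} {n K : nat}
    (G : 'I_n.+1 -> T -> 'I_K) (Z : 'I_n.+1 -> T -> (X1 * Y)%type)
    (s : ('I_K * X1)%type -> Y -> R) (q : 'I_K -> R) (alpha : R)
    (h : {ffun 'I_n -> 'I_K}) (w : T) :
  (forall k, 0 <= q k) -> alpha < 1 -> config G h w ->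
  (~ covered G Z s q alpha w) <->
  (1 - alpha <= mass_below (group_weight q h)
     (fun j => score G Z s (cal j) w) (score G Z s ord_max w)).
Proof.
move=> q0 a1 hw.
set S := fun j => _; set y := score _ _ _ ord_max w.
have c0 j : 0 <= group_weight q h j by rewrite divr_ge0.
(* Below [+oo] an unobserved group contributes nothing, its mass being an atom at [+oo]. *)
have Fr (t : \bar R) : (t < +oo)%E ->
    \sum_k q k * emp_cdf G Z s w k t =
    \sum_j group_weight q h j * ((S j)%:E <= t)%E%:R.
  move=> too; rewrite (sum_group_weight q h) [RHS]big_mkcond/=.
  apply: eq_bigr => k _; rewrite /emp_cdf (ncount_config k hw).
  case: ifPn => // _; last by rewrite leNgt too mulr0.
  by congr (_ * (_ * _)); apply: eq_bigl => j; rewrite hw.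
rewrite /covered /= /gwcp_qhat /quantile_of; split.
  move=> /negP; rewrite -ltNge => /ereal_inf_lt[t [tNy at_] ty].
  have too : (t < +oo)%E by apply: lt_le_trans ty _; exact: leey.
  apply: le_trans at_ _; rewrite (Fr _ too).
  apply: ler_sum => j _; apply: ler_wpM2l => //.
  case: (boolP (_ <= t)%E) => // St.
  by rewrite -lte_fin (le_lt_trans St ty).
move=> ay; apply/negP; rewrite -ltNge; apply/ereal_inf_ltP.
(* Otherwise the mass below [y] would be 0, whereas [1 - alpha] is positive. *)
have [j0 j0y] : exists j, S j < y.
  apply/not_existsP => ny; move: ay; rewrite /mass_below big1 => [|j _]; first lra.
  by case: (boolP (S j < y)) => [/ny//|_]; rewrite mulr0.
have [i iy imax] := Order.TotalTheory.arg_maxP (P := fun j => S j < y) S j0y.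
exists (S i)%:E; last by rewrite lte_fin.
split=> //; apply: le_trans ay _; rewrite Fr ?ltry//.
apply: ler_sum => j _; apply: ler_wpM2l => //.
case: (boolP (S j < y)) => // /imax Sji.
have {}Sji : S j <= S i by [].
by rewrite lee_fin Sji.
Qed.

(** * Expectation of the largest ratio of [q k] to the group count *)

Lemma sum_config_prod {R : realType} (n K : nat) (p f : 'I_K -> R) :
  \sum_(h : {ffun 'I_n -> 'I_K}) (\prod_j p (h j)) * (\prod_j f (h j)) =
  (\sum_k p k * f k) ^+ n.
Proof.
under eq_bigr do rewrite -big_split/=.
by rewrite -(bigA_distr_bigA (fun (_ : 'I_n) k => p k * f k)) prodr_const card_ord.
Qed.

Section expected_group_max.
Context {R : realType} {n K : nat} (p q : 'I_K -> R).
Hypothesis p0 : forall k, 0 <= p k.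
Hypothesis p1 : \sum_k p k = 1.
Hypothesis q0 : forall k, 0 <= q k.

Let M := \big[Num.max/0]_k (q k / p k).

Let qM k : 0 < p k -> q k <= M * p k.
Proof.
by move=> pk; rewrite -ler_pdivrMr//; exact: (le_bigmax _ (fun k => q k / p k)).
Qed.

Let M0 : 0 <= M. Proof. exact: bigmax_ge_id. Qed.

(* A group with fewer than a third of its expected count [n * p k] is paid for by the
   exponential moment of its count, since [2 ^ c <= expR c].
   Groups with [p k = 0], where [q k / p k] is the junk value [0], are possible when [n <= 1]; they
   are almost surely unobserved, hence the hypothesis on [h] and the restricted sum. *)
Lemma group_max_le (h : {ffun 'I_n -> 'I_K}) : (0 < n)%N ->
  (forall j, 0 < p (h j)) ->
  group_max q h <= 3 * n%:R^-1 * M +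
    \sum_(k | 0 < p k) q k * expR (n%:R * p k / 3) * 2^-1 ^+ group_count h k.
Proof.
move=> n0 hp; have n0' : 0 < n%:R :> R by rewrite ltr0n.
have t0 k : 0 <= q k * expR (n%:R * p k / 3) * 2^-1 ^+ group_count h k.
  by rewrite !mulr_ge0// ?expR_ge0// exprn_ge0.
have s0 : 0 <= 3 * n%:R^-1 * M by rewrite !mulr_ge0// invr_ge0 ltW.
apply: bigmax_le => [|k k0]; first by rewrite addr_ge0// sumr_ge0.
have pk : 0 < p k.
  by case/card_gt0P : (k0) => j; rewrite inE => /eqP <-.
have c0 : 0 < (group_count h k)%:R :> R by rewrite ltr0n.
have [big|small] := leP (n%:R * p k / 3) (group_count h k)%:R.
  rewrite ler_wpDr ?sumr_ge0// ler_pdivrMr//.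
  apply: (le_trans (qM pk)).
  have -> : M * p k = 3 * n%:R^-1 * M * (n%:R * p k / 3) by field; lra.
  exact: ler_wpM2l.
(* Only the summand of [k] is kept; the count is at least 1, so the ratio is at most [q k]. *)
rewrite ler_wpDl// (bigD1 k)//= ler_wpDr ?sumr_ge0//.
rewrite -mulrA; apply: ler_wpM2l => //; apply: (@le_trans _ _ 1).
  by rewrite invf_le1// ler1n.
rewrite exprVn ler_pdivlMr ?exprn_gt0// mul1r.
have : 2 ^+ group_count h k <= expR (group_count h k)%:R :> R.
  rewrite -[(group_count h k)%:R]mulr1 expRM_natl lerXn2r ?nnegrE ?expR_ge0//.
  by have := expR_ge1Dx (1 : R); lra.
by move=> /le_trans; apply; rewrite ler_expR ltW.
Qed.

(** The constant is 3 + 1: [3 * M / n] from groups near their expected size, and [M / n] from the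
    exponential moments. *)
Lemma expected_group_max :
  (forall k, 8 * ln n%:R / n%:R <= p k) ->
  \sum_(h : {ffun 'I_n -> 'I_K}) group_max q h * \prod_j p (h j) <=
  4 * n%:R^-1 * M.
Proof.
move=> hp; have [n0|n0] := posnP n.
  (* Without calibration points no group is observed, and the maximum takes its default value 0. *)
  rewrite big1 => [|h _]; first by rewrite !mulr_ge0// invr_ge0.
  rewrite [group_max q h]big_pred0 ?mul0r// => k.
  by apply/negP => /card_gt0P[[j jn]]; exfalso; rewrite n0 in jn.
have n0' : 0 < n%:R :> R by rewrite ltr0n.
have tot : \sum_(h : {ffun 'I_n -> 'I_K}) \prod_j p (h j) = 1.
  transitivity ((\sum_k p k * (fun=> 1) k) ^+ n); last first.
    by under eq_bigr do rewrite mulr1; rewrite p1 expr1n.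
  rewrite -sum_config_prod; apply: eq_bigr => h _.
  by rewrite [X in _ * X]big1 ?mulr1.
have mom k : \sum_(h : {ffun 'I_n -> 'I_K})
    2^-1 ^+ group_count h k * \prod_j p (h j) <= expR (- (n%:R * p k / 2)).
  (* A factor 1/2 for each point of group [k] makes [2^-1 ^+ group_count h k] a product over the
     points, so the sum factorises. *)
  pose f l : R := if l == k then 2^-1 else 1.
  rewrite (eq_bigr (fun h : {ffun 'I_n -> 'I_K} =>
      (\prod_j p (h j)) * (\prod_j f (h j)))) => [|h _]; last first.
    rewrite mulrC; congr (_ * _); rewrite /group_count -prodr_const big_mkcond.
    by apply: eq_bigr => j _; rewrite inE.
  rewrite sum_config_prod.
  have -> : \sum_l p l * f l = 1 - p k / 2.
    rewrite (bigD1 k)//= /f eqxx.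
    under eq_bigr => l lk do rewrite (negbTE lk) mulr1.
    by have := p1; rewrite (bigD1 k)//=; lra.
  have -> : - (n%:R * p k / 2) = n%:R * (- (p k / 2)) by lra.
  rewrite expRM_natl; apply: lerXn2r; rewrite ?nnegrE ?expR_ge0//.
    have : p k <= 1 by rewrite -p1 (bigD1 k)//= ler_wpDr// sumr_ge0.
    lra.
  exact: expR_ge1Dx.
apply: (@le_trans _ _ (\sum_(h : {ffun 'I_n -> 'I_K}) (3 * n%:R^-1 * M +
    \sum_(k | 0 < p k) q k * expR (n%:R * p k / 3) * 2^-1 ^+ group_count h k) *
    \prod_j p (h j))).
  apply: ler_sum => h _.
  have [hp0|] := pselect (forall j, 0 < p (h j)).
    by apply: ler_wpM2r; [exact: prodr_ge0|exact: group_max_le].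
  (* A configuration containing a label of probability 0 has weight 0. *)
  move=> /existsNP[j /negP]; rewrite lt_neqAle p0 andbT negbK => /eqP pj.
  by rewrite (bigD1 j)//= -pj mul0r !mulr0.
under eq_bigr do rewrite mulrDl mulr_suml.
rewrite big_split/= -mulr_sumr tot mulr1 exchange_big/=.
have -> : 4 * n%:R^-1 * M = 3 * n%:R^-1 * M + n%:R^-1 * M by lra.
apply: lerD => //.
(* Bounding [q k] by [M * p k] lets the sum over groups be absorbed by the total mass of [p], with
   no factor [K]. *)
apply: (@le_trans _ _ (\sum_(k | 0 < p k) n%:R^-1 * M * p k)); last first.
  rewrite -mulr_sumr ler_piMr ?mulr_ge0 ?invr_ge0//.
  by rewrite -p1 [leRHS](bigID (fun k => 0 < p k))/= ler_wpDr// sumr_ge0.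
apply: ler_sum => k pk; apply: (@le_trans _ _ (q k * n%:R^-1)); last first.
  by rewrite -mulrA mulrC; apply: ler_wpM2l; [rewrite invr_ge0 ltW|exact: qM].
under eq_bigr do rewrite -!mulrA.
rewrite -!mulr_sumr; apply: ler_wpM2l => //.
apply: (@le_trans _ _ (expR (n%:R * (p k / 3)) * expR (- (n%:R * p k / 2)))).
  by apply: ler_wpM2l; [exact: expR_ge0|exact: mom].
(* The exponent is [- n p_k / 6], at most [- (8 / 6) ln n] by hypothesis, hence at most [- ln n]. *)
rewrite -expRD -[n%:R^-1]lnK ?posrE ?invr_gt0// ler_expR lnV ?posrE//.
have := hp k; rewrite ler_pdivrMr//.
have : 0 <= ln n%:R :> R by rewrite ln_ge0// ler1n.
lra.
Qed.
End expected_group_max.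

(** * Decomposition along a finite-valued label *)

(** Reduces measurability of the uncovered event to pieces with fixed labels, where it is an
    explicit inequality between scores. *)
Lemma measurable_level {d : measure_display} {T : measurableType d} (I : finType)
    (f : T -> I) (A : set T) :
  (forall t, measurable (A `&` f @^-1` [set t])) -> measurable A.
Proof.
move=> mA; rewrite [A](_ : _ = \bigcup_(t in [set: I]) (A `&` f @^-1` [set t])).
  by apply: fin_bigcup_measurable => [|t _]; [exact: finite_finset|exact: mA].
by apply/seteqP; split=> [w Aw|w [t _ []]//]; exists (f w).
Qed.

Lemma sum_level {R : realType} {d : measure_display} {T : measurableType d}
    (P : probability T R) (I : finType) (f : T -> I) (A : set T) :
  (forall t, measurable (A `&` f @^-1` [set t])) ->
  P A = (\sum_t P (A `&` f @^-1` [set t]))%E.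
Proof.
move=> mA; rewrite [in LHS](_ : A = \bigcup_(t in [set: I]) (A `&` f @^-1` [set t])).
  rewrite measure_fin_bigcup//.
  - rewrite (fsbigE (index_enum I)) ?index_enum_uniq//=.
      by apply: eq_bigl => i; rewrite in_setT.
    by move=> i _; rewrite mem_index_enum.
  - exact: finite_finset.
  - by move=> i j _ _ [w [[_ /= <-] [_ /= <-]]].
by apply/seteqP; split=> [w Aw|w [t _ []]//]; exists (f w).
Qed.

(** * Symmetry and independence of scores for fixed labels *)

Section gwcp_coverage.
Context {R : realType} {d : measure_display} {Omega : measurableType d}
  {d1 : measure_display} {X1 : measurableType d1}
  {dy : measure_display} {Y : measurableType dy} {K n : nat}.
Variables (p q : 'I_K -> R) (Pi : 'I_K -> probability (X1 * Y)%type R)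
  (P : probability Omega R) (G : 'I_n.+1 -> Omega -> 'I_K)
  (Z : 'I_n.+1 -> Omega -> (X1 * Y)%type) (s : ('I_K * X1)%type -> Y -> R).
Hypothesis mG : forall i k, measurable (G i @^-1` [set k]).
Hypothesis mZ : forall i, measurable_fun setT (Z i).
Hypothesis indep : mutually_independent P G Z.
Hypothesis lawP :
  forall i : 'I_n, has_group_mixture_law P (G (cal i)) (Z (cal i)) p Pi.
Hypothesis lawQ : has_group_mixture_law P (G ord_max) (Z ord_max) q Pi.
Hypothesis ms : forall k, measurable_fun setT (fun z : X1 * Y => s (k, z.1) z.2).

(** The score with its label frozen at [k]: a measurable function of [Z i] alone, equal to the true
    score where [G i] is [k]. *)
Let V (k : 'I_K) (i : 'I_n.+1) (w : Omega) : R := s (k, (Z i w).1) (Z i w).2.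

Let mV k i : measurable_fun setT (V k i).
Proof. exact: measurableT_comp (ms k) (mZ i). Qed.

Definition extend (h : {ffun 'I_n -> 'I_K}) (k : 'I_K) (i : 'I_n.+1) : 'I_K :=
  if unlift ord_max i is Some j then h j else k.

Lemma cal_lift (j : 'I_n) : cal j = lift ord_max j.
Proof. by apply: ord_inj; rewrite lift_max. Qed.

Lemma extend_cal h k j : extend h k (cal j) = h j.
Proof. by rewrite /extend cal_lift liftK. Qed.

Lemma extend_max h k : extend h k ord_max = k.
Proof. by rewrite /extend unlift_none. Qed.

Lemma ord_cal_max (i : 'I_n.+1) : (exists j, i = cal j) \/ i = ord_max.
Proof.
by case: (unliftP ord_max i) => [j ->|->]; [left; exists j; rewrite cal_lift|right].
Qed.

Lemma config_preimage h :
  config G h = (fun w => [ffun j => G (cal j) w]) @^-1` [set h].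
Proof.
apply/seteqP; split=> w /= hw; first by apply/ffunP => j; rewrite ffunE hw.
by move=> j; rewrite -hw ffunE.
Qed.

Lemma measurable_config h : measurable (config G h).
Proof.
rewrite [X in measurable X](_ : _ =
    \bigcap_(j in [set: 'I_n]) G (cal j) @^-1` [set h j]).
  by apply: fin_bigcap_measurable => [|j _]; [exact: finite_finset|exact: mG].
by apply/seteqP; split=> w hw j //; [move=> _|]; exact: (hw j).
Qed.

Let full_config h k := config G h `&` G ord_max @^-1` [set k].

Lemma full_configE h k w : full_config h k w <-> forall i, G i w = extend h k i.
Proof.
split=> [[hw kw] i|gw].
  by case: (ord_cal_max i) => [[j ->]|->]; rewrite ?extend_cal ?extend_max.
by split=> [j|]; rewrite /= gw ?extend_cal ?extend_max.
Qed.

Let mfull h k : measurable (full_config h k).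
Proof. by apply: measurableI; [exact: measurable_config|exact: mG]. Qed.

(** Calibration and test points differ only in their label weights; given the label, both follow the
    same [Pi]. *)
Let wt (i : 'I_n.+1) : 'I_K -> R := if unlift ord_max i is Some _ then p else q.

Let law i : has_group_mixture_law P (G i) (Z i) (wt i) Pi.
Proof.
case: (ord_cal_max i) => [[j ->]|->]; last by rewrite /wt unlift_none.
by rewrite /wt cal_lift liftK -cal_lift.
Qed.

Let preB k (B : set R) : measurable B ->
  measurable [set z : X1 * Y | B (s (k, z.1) z.2)].
Proof. by move=> mB; rewrite -[X in measurable X]setTI; exact: ms. Qed.

(** The right-hand side does not involve [t]: permuting points within their groups preserves the
    joint law of the scores, since points with equal labels have equal conditional laws. *)
Lemma full_config_rect h k (t : {perm 'I_n.+1}) (B : 'I_n.+1 -> set R) :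
  (forall i, measurable (B i)) ->
  (forall i, extend h k (t i) = extend h k i) ->
  P ([set w | forall i, B i (V (extend h k i) (t i) w)] `&` full_config h k) =
  ((\prod_i (wt i (extend h k i))%:E) *
   \prod_i Pi (extend h k i)
     [set z : X1 * Y | B i (s (extend h k i, z.1) z.2)])%E.
Proof.
move=> mB gt; set g := extend h k.
(* The constraint [B i] bears on point [t i], so point [i] receives the one indexed by its
   preimage. *)
pose A i := [set z : X1 * Y | B ((t^-1)%g i) (s (g i, z.1) z.2)].
have mA i : measurable (A i) by exact: preB.
have gtV i : g ((t^-1)%g i) = g i by rewrite /g -(gt ((t^-1)%g i)) permKV.
have -> : [set w | forall i, B i (V (g i) (t i) w)] `&` full_config h k =
    \bigcap_(i in [set: 'I_n.+1]) (G i @^-1` [set g i] `&` Z i @^-1` A i).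
  apply/seteqP; split=> [w [wB /full_configE gw] i _|w wA].
    split; first exact: gw.
    by have := wB ((t^-1)%g i); rewrite /V /A /= permKV gtV.
  split; last by apply/full_configE => i; case: (wA i I).
  by move=> i; have [_] := wA (t i) I; rewrite /A /= permK /g gt.
rewrite indep//; under eq_bigr do rewrite law//.
rewrite big_split/=; congr (_ * _)%E.
rewrite (reindex_inj (@perm_inj _ t)); apply: eq_bigr => i _.
by rewrite /A /g permK gt.
Qed.

Lemma config_rect (h : {ffun 'I_n -> 'I_K}) k (B : 'I_n -> set R) : (forall j, measurable (B j)) ->
  P ([set w | forall j, B j (V (h j) (cal j) w)] `&` full_config h k) =
  ((q k)%:E * P ([set w | forall j, B j (V (h j) (cal j) w)] `&` config G h))%E.
Proof.
move=> mB.
pose A (i : 'I_n.+1) : set (X1 * Y) := if unlift ord_max i is Some j then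
  [set z | B j (s (h j, z.1) z.2)] else setT.
pose S (T : set 'I_K) (i : 'I_n.+1) : set 'I_K :=
  if unlift ord_max i is Some j then [set h j] else T.
have mA i : measurable (A i) by rewrite /A; case: unliftP => // j _; exact: preB.
(* Used with [T] equal to [[set k]] and to the full set, for the two sides of the claim. *)
have key (T : set 'I_K) :
    P ([set w | forall j, B j (V (h j) (cal j) w)] `&`
       (config G h `&` G ord_max @^-1` T)) =
    (\prod_(j < n) P (G (cal j) @^-1` [set h j] `&`
       Z (cal j) @^-1` [set z | B j (s (h j, z.1) z.2)]) *
     P (G ord_max @^-1` T))%E.
  have -> : [set w | forall j, B j (V (h j) (cal j) w)] `&`
       (config G h `&` G ord_max @^-1` T) =
      \bigcap_(i in [set: 'I_n.+1]) (G i @^-1` S T i `&` Z i @^-1` A i).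
    apply/seteqP; split=> [w [wB [hw Tw]] i _|w wA].
      rewrite /S /A; case: unliftP => [j ->|->] //.
      by rewrite -cal_lift; split; [exact: hw|exact: wB].
    split=> [j|]; last split=> [j|].
    - by have [_] := wA (cal j) I; rewrite /A cal_lift liftK.
    - by have [+ _] := wA (cal j) I; rewrite /S cal_lift liftK.
    - by have [+ _] := wA ord_max I; rewrite /S unlift_none.
  rewrite indep// big_ord_recr/=; congr (_ * _)%E.
    by apply: eq_bigr => j _; rewrite -/(cal j) cal_lift /S /A liftK.
  by rewrite /S /A unlift_none preimage_setT setIT.
rewrite key -[config G h in RHS]setIT -(preimage_setT (G ord_max)) key.
rewrite preimage_setT probability_setT mule1 muleC; congr (_ * _)%E.
have := lawQ k measurableT; rewrite preimage_setT setIT => ->.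
by rewrite probability_setT mule1.
Qed.

(** * Miscoverage for fixed calibration labels *)

Variable alpha : R.
Hypothesis q0 : forall k, 0 <= q k.
Hypothesis q1 : \sum_k q k = 1.
Hypothesis alpha01 : 0 < alpha < 1.

(** What miscoverage becomes once calibration point [i] plays the test point; the threshold is
    lowered by the cost of the exchange. *)
Let high h (i : 'I_n) : set Omega :=
  [set w | 1 - alpha - group_max q h <=
    mass_below (group_weight q h) (fun j => V (h j) (cal j) w) (V (h i) (cal i) w)].

Let uncovered : set Omega := ~` covered G Z s q alpha.

Let mhigh h i : measurable (high h i).
Proof. by apply: measurable_mass_below => [j|]; exact: mV. Qed.

Let high_tuple h i : set (n.-tuple R) :=
  [set x | 1 - alpha - group_max q h <=
    mass_below (group_weight q h) (tnth x) (tnth x i)].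

Lemma full_config_indep (h : {ffun 'I_n -> 'I_K}) k (E : set (n.-tuple R)) :
  measurable E ->
  P ([set w | E [tuple V (h j) (cal j) w | j < n]] `&` full_config h k) =
  ((q k)%:E * P ([set w | E [tuple V (h j) (cal j) w | j < n]] `&` config G h))%E.
Proof.
move=> mE; apply: (@eq_joint_law _ _ _ _ _ _ P _ _ _ _ (NngNum (q0 k))) => //.
- exact: measurable_config.
- by move=> B mB; exact: config_rect.
Qed.

Lemma full_config_prob h k : P (full_config h k) = ((q k)%:E * P (config G h))%E.
Proof.
by have := @full_config_indep h k setT measurableT; rewrite !setTI.
Qed.

Lemma high_indep h k i :
  P (high h i `&` full_config h k) = ((q k)%:E * P (high h i `&` config G h))%E.
Proof.
have -> : high h i = [set w | high_tuple h i [tuple V (h j) (cal j) w | j < n]].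
  apply/seteqP; split=> w; rewrite /high /high_tuple /= tnth_mktuple;
    by rewrite (@mass_below_ext _ _ _ _ (fun j => V (h j) (cal j) w))// => j;
       rewrite tnth_mktuple.
apply: full_config_indep; apply: measurable_mass_below => [j|]; exact: measurable_tnth.
Qed.

Lemma uncovered_full_config h k :
  uncovered `&` full_config h k =
  [set w | 1 - alpha <= mass_below (group_weight q h)
    (fun j => V (h j) (cal j) w) (V k ord_max w)] `&` full_config h k.
Proof.
have a1 : alpha < 1 by case/andP: alpha01.
have eqs w : full_config h k w ->
    mass_below (group_weight q h) (fun j => score G Z s (cal j) w)
      (score G Z s ord_max w) =
    mass_below (group_weight q h) (fun j => V (h j) (cal j) w) (V k ord_max w).
  move=> [hw kw]; rewrite /score kw; apply: mass_below_ext => j.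
  by rewrite hw.
apply/seteqP; split=> w [uw hkw]; (split=> //; have [hw _] := hkw).
  by rewrite /= -eqs//; exact/(uncovered_config Z s q0 a1 hw).
by apply/(uncovered_config Z s q0 a1 hw); rewrite eqs.
Qed.

Lemma measurable_uncovered_full h k : measurable (uncovered `&` full_config h k).
Proof.
rewrite uncovered_full_config; apply: measurableI => //.
by apply: measurable_mass_below => [j|]; exact: mV.
Qed.

Lemma measurable_uncovered_config h : measurable (uncovered `&` config G h).
Proof.
apply: (@measurable_level _ _ _ (G ord_max)) => k.
by rewrite -setIA; exact: measurable_uncovered_full.
Qed.

Lemma measurable_uncovered : measurable uncovered.
Proof.
apply: (@measurable_level _ _ _ (fun w => [ffun j => G (cal j) w])) => h.
by rewrite -config_preimage; exact: measurable_uncovered_config.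
Qed.

Lemma group_weight_ge0 (h : {ffun 'I_n -> 'I_K}) j : 0 <= group_weight q h j.
Proof. by rewrite divr_ge0. Qed.

Lemma group_weight_le_max (h : {ffun 'I_n -> 'I_K}) j : group_weight q h j <= group_max q h.
Proof.
apply: (le_bigmax_cond 0 (fun k => q k / (group_count h k)%:R)).
by apply/card_gt0P; exists j; rewrite inE.
Qed.

Lemma group_max_ge0 (h : {ffun 'I_n -> 'I_K}) : 0 <= group_max q h.
Proof. exact: bigmax_ge_id. Qed.

(* Exchanging the test point with a calibration point of its own group replaces one summand
   of the weighted count, which shifts the count by at most [group_max q h]. *)
Lemma uncovered_le_high (h : {ffun 'I_n -> 'I_K}) k i : h i = k ->
  (P (uncovered `&` full_config h k) <= P (high h i `&` full_config h k))%E.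
Proof.
move=> hik; rewrite uncovered_full_config.
pose t := tperm (cal i) ord_max; pose g := extend h k.
have gt j : g (t j) = g j.
  by rewrite /t; case: tpermP => // ->; rewrite /g extend_cal extend_max.
pose W (t : {perm 'I_n.+1}) (w : Omega) : n.+1.-tuple R :=
  [tuple V (g j) (t j) w | j < n.+1].
pose E : set (n.+1.-tuple R) := [set x | 1 - alpha <=
  mass_below (group_weight q h) (fun j => tnth x (cal j)) (tnth x ord_max)].
have -> : [set w | 1 - alpha <= mass_below (group_weight q h)
    (fun j => V (h j) (cal j) w) (V k ord_max w)] = [set w | E (W 1%g w)].
  apply/seteqP; split=> w; rewrite /E /W /g /= !tnth_mktuple !perm1 extend_max;
    by rewrite (@mass_below_ext _ _ _ _ (fun j => V (h j) (cal j) w))// => j;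
       rewrite tnth_mktuple perm1 extend_cal.
have mE : measurable E.
  by apply: measurable_mass_below => [j|]; exact: measurable_tnth.
(* The identity and the transposition give every rectangle the same probability, hence every
   event. *)
have := @eq_joint_law _ _ _ _ _ _ P _ _ (fun j => V (g j) ((1%g : {perm 'I_n.+1}) j))
  (fun j => V (g j) (t j)) (NngNum (@ler01 R)) (@mfull h k) (@mfull h k)
  (fun j => mV _ _) (fun j => mV _ _) _ E mE.
rewrite mul1e => -> => [|B mB]; last first.
  by rewrite mul1e full_config_rect// ?full_config_rect// => j; rewrite perm1.
apply: le_measure; rewrite ?inE.
- apply: measurableI => //; apply: measurable_mass_below => [j|];
  by apply: eq_measurable_fun (mV _ _) => w _; rewrite tnth_mktuple.
- exact: measurableI.
move=> w [Ew hkw]; split=> //; move: Ew.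
rewrite /E /high /= tnth_mktuple /t tpermR /g extend_max -hik => Ew.
rewrite lerBlDr; apply: (le_trans Ew).
(* After the swap, summand [i] on the left compares the test score with that of [i]; on the right it
   compares the score of [i] with itself and vanishes. *)
rewrite /mass_below (bigD1 i)//= [in leRHS](bigD1 i)//= ltxx mulr0 add0r addrC.
apply: lerD; last first.
  apply: le_trans (group_weight_le_max h i).
  by case: (_ < _)%R; rewrite ?mulr1 ?mulr0 ?group_weight_ge0.
apply: ler_sum => j ji; rewrite tnth_mktuple tpermD ?extend_cal//.
- by apply: contra ji => /eqP /(congr1 val)/= ij; apply/eqP/val_inj.
- by rewrite cal_lift neq_lift.
Qed.

Lemma fine_prob (A : set Omega) : measurable A -> P A = (fine (P A))%:E.
Proof. by move=> mA; rewrite fineK// fin_num_measure. Qed.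

(** An observed group averages the exchange bound over its points. An unobserved one offers no
    partner, so only the necessary condition that the total weight reach [1 - alpha] is kept. *)
Lemma uncovered_full_config_le (h : {ffun 'I_n -> 'I_K}) k :
  (P (uncovered `&` full_config h k) <= (q k *
    (if (0 < group_count h k)%N
     then (group_count h k)%:R^-1 *
       \sum_(i | h i == k) fine (P (high h i `&` config G h))
     else (1 - alpha <= \sum_j group_weight q h j)%R%:R * fine (P (config G h))))%:E)%E.
Proof.
case: ifPn => [k0|_].
  have ub i : h i = k -> fine (P (uncovered `&` full_config h k)) <=
      q k * fine (P (high h i `&` config G h)).
    move=> hik; rewrite -lee_fin -fine_prob; last exact: measurable_uncovered_full.
    rewrite EFinM -fine_prob; last first.
      by apply: measurableI => //; exact: measurable_config.
    by rewrite -high_indep; exact: uncovered_le_high.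
  rewrite fine_prob; last exact: measurable_uncovered_full.
  rewrite lee_fin mulrCA ler_pdivlMl ?ltr0n// mulr_sumr.
  rewrite mulr_natl -sumr_const.
  by apply: ler_sum => i /eqP; exact: ub.
rewrite uncovered_full_config; have [cs|cs] := boolP (1 - alpha <= _).
  rewrite mul1r EFinM -fine_prob; last exact: measurable_config.
  rewrite -full_config_prob; apply: le_measure; rewrite ?inE//.
  apply: measurableI => //.
  by apply: measurable_mass_below => [j|]; exact: mV.
rewrite mul0r mulr0 (_ : _ `&` _ = set0) ?measure0//.
apply/seteqP; split=> // w [/= aw _]; move/negP : cs; apply.
apply: le_trans aw _; apply: mass_below_le => j; exact: group_weight_ge0.
Qed.

Lemma uncovered_config_le (h : {ffun 'I_n -> 'I_K}) :
  (P (uncovered `&` config G h) <=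
    (alpha + group_max q h)%:E * P (config G h))%E.
Proof.
set pi := fine (P (config G h)).
have mconf := measurable_config h.
set e := fun i => fine (P (high h i `&` config G h)).
set sc := \sum_j group_weight q h j.
(* The missing weight [1 - sc] is the mass of the atom at [+oo], and equally the probability that
   the test point falls in an unobserved group. *)
have sc1 : \sum_(k | ~~ (0 < group_count h k)%N) q k = 1 - sc.
  rewrite /sc sum_group_weight1.
  have := q1; rewrite (bigID (fun k => (0 < group_count h k)%N))/= => <-.
  by rewrite addrAC subrr add0r.
have scle : sc <= 1.
  by rewrite -subr_ge0 -sc1; apply: sumr_ge0 => k _.
have step : \sum_i group_weight q h i * e i <=
    (alpha + group_max q h - (1 - sc) * (1 - alpha <= sc)%R%:R) * pi.
  rewrite -lee_fin EFinM -[pi%:E]fine_prob// -sumEFin.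
  rewrite (eq_bigr (fun i => (group_weight q h i)%:E *
      P (high h i `&` config G h)))%E => [|i _]; last first.
    by rewrite EFinM -fine_prob//; exact: measurableI.
  apply: sum_measure_le => // [i|w _]; first exact: group_weight_ge0.
  have /andP[a0 _] := alpha01.
  have := heavy_rank_mass_le (fun j => V (h j) (cal j) w) (group_weight_ge0 h) scle
    (ltW a0) (group_max_ge0 h).
  rewrite -lerBrDr; apply: le_trans; apply: ler_sum => i _.
  rewrite ler_wpM2l ?group_weight_ge0// indicE.
  case: (boolP (w \in high h i)) => [wh|_]; last exact: ler0n.
  by have := set_mem wh; rewrite /high /= => ->.
rewrite (@sum_level _ _ _ _ _ (G ord_max)) => [|k]; last first.
  by rewrite -setIA; exact: measurable_uncovered_full.
rewrite [P (config G h)]fine_prob// -EFinM.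
apply: (@le_trans _ _ (\sum_k (q k *
    (if (0 < group_count h k)%N
     then (group_count h k)%:R^-1 * \sum_(i | h i == k) e i
     else (1 - alpha <= sc)%R%:R * pi)))%:E).
  rewrite -sumEFin; apply: lee_sum => k _; rewrite -setIA.
  exact: uncovered_full_config_le.
rewrite lee_fin (bigID (fun k => (0 < group_count h k)%N))/=.
under eq_bigr => k k0 do rewrite k0.
(* The within-group averages, weighted by [q k], reassemble into the weights of the individual
   points. *)
rewrite -sum_group_weight.
under [X in _ + X]eq_bigr => k k0 do rewrite (negbTE k0).
rewrite -mulr_suml sc1.
have := step; rewrite -/pi; lra.
Qed.

(** * Averaging over the calibration labels *)

(** A function of the calibration labels alone is a finite combination of indicators of
    configurations. *)
Lemma sum_config (f : {ffun 'I_n -> 'I_K} -> R) (g : Omega -> R) :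
  (forall h, 0 <= f h) -> (forall h w, config G h w -> g w = f h) ->
  (\int[P]_w (g w)%:E = \sum_h (f h)%:E * P (config G h))%E.
Proof.
move=> f0 gf.
have gE w : (g w)%:E = (\sum_h (f h)%:E * (\1_(config G h) w)%:E)%E.
  pose h0 := [ffun j => G (cal j) w].
  have h0w : config G h0 w by move=> j; rewrite ffunE.
  rewrite (bigD1 h0)//= big1 => [|h hh0].
    by rewrite adde0 indicE mem_set// mule1 (gf h0).
  rewrite indicE memNset ?mule0// => hw; move/eqP: hh0; apply.
  by apply/ffunP => j; rewrite ffunE hw.
under eq_integral do rewrite gE.
rewrite ge0_integral_sum//=.
- apply: eq_bigr => h _; rewrite ge0_integralZl ?lee_fin//.
  + by rewrite integral_indic ?setIT//; exact: measurable_config.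
  + by apply/measurable_EFinP/measurable_indic; exact: measurable_config.
- move=> h; apply/measurable_EFinP/measurable_funM => //.
  by apply: measurable_indic; exact: measurable_config.
- by move=> h w _; rewrite mule_ge0// lee_fin.
Qed.

Lemma sum_config_prob : (\sum_h P (config G h) = 1)%E.
Proof.
rewrite -(probability_setT P) (sum_level P (f := fun w => [ffun j => G (cal j) w])).
  by apply: eq_bigr => h _; rewrite setTI config_preimage.
by move=> h; rewrite setTI -config_preimage; exact: measurable_config.
Qed.

Lemma coverage_ge :
  ((1 - alpha)%:E - \int[P]_w (max_ratio G q w)%:E <= P (covered G Z s q alpha))%E.
Proof.
have mU := measurable_uncovered; pose pi h := fine (P (config G h)).
have piE h : P (config G h) = (pi h)%:E by apply/fine_prob/measurable_config.
have := sum_config_prob; under eq_bigr do rewrite piE.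
rewrite sumEFin => -[pi1].
rewrite (sum_config group_max_ge0); last by move=> h w; exact: max_ratio_config.
rewrite -[covered _ _ _ _ _]setCK -/uncovered probability_setC//.
have : (P uncovered <= (\sum_h (alpha + group_max q h) * pi h)%:E)%E.
  rewrite (sum_level P (f := fun w => [ffun j => G (cal j) w])).
    rewrite -sumEFin; apply: lee_sum => h _.
    by rewrite -config_preimage EFinM -piE; exact: uncovered_config_le.
  by move=> h; rewrite -config_preimage; exact: measurable_uncovered_config.
under [in leRHS]eq_bigr do rewrite mulrDl.
rewrite big_split/= -mulr_sumr pi1 mulr1.
under [in X in (_ -> X)]eq_bigr do rewrite piE -EFinM.
rewrite sumEFin [P uncovered]fine_prob// !lee_fin; lra.
Qed.

Lemma config_prob (h : {ffun 'I_n -> 'I_K}) :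
  P (config G h) = (\prod_j p (h j))%:E.
Proof.
pose S (i : 'I_n.+1) : set 'I_K :=
  if unlift ord_max i is Some j then [set h j] else setT.
have -> : config G h =
    \bigcap_(i in [set: 'I_n.+1]) (G i @^-1` S i `&` Z i @^-1` setT).
  apply/seteqP; split=> [w hw i _|w wS j]; last first.
    by have [+ _] := wS (cal j) I; rewrite /S cal_lift liftK.
  by split=> //; rewrite /S; case: unliftP => // j ->; rewrite /= -cal_lift hw.
rewrite indep// big_ord_recr/= /S unlift_none !preimage_setT setTI.
rewrite probability_setT mule1 -prodEFin; apply: eq_bigr => j _.
by rewrite -/(cal j) [in unlift _ _]cal_lift liftK lawP// probability_setT mule1.
Qed.

Lemma coverage_ge_rate : prob_vector p ->
  (forall k, 8 * ln n%:R / n%:R <= p k) ->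
  ((1 - alpha - 4 * n%:R^-1 * \big[Num.max/0]_(k : 'I_K) (q k / p k))%:E
    <= P (covered G Z s q alpha))%E.
Proof.
move=> [p0 p1] hp; apply: le_trans coverage_ge.
rewrite (sum_config group_max_ge0); last by move=> h w; exact: max_ratio_config.
under [X in (_ - X)%E]eq_bigr do rewrite config_prob -EFinM.
by rewrite sumEFin -EFinB lee_fin lerB// expected_group_max.
Qed.

End gwcp_coverage.

Theorem theorem2 (R : realType) (d : measure_display) (Omega : measurableType d)
  (d1 : measure_display) (X1 : measurableType d1)
  (dy : measure_display) (Y : measurableType dy)
  (K n : nat) (p q : 'I_K -> R) (Pi : 'I_K -> probability (X1 * Y)%type R)
  (alpha : R) (P : probability Omega R)
  (G : 'I_n.+1 -> Omega -> 'I_K) (Z : 'I_n.+1 -> Omega -> (X1 * Y)%type)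
  (s : ('I_K * X1)%type -> Y -> R) :
  (0 < K)%N ->
  prob_vector p -> prob_vector q ->
  0 < alpha < 1 ->
  (forall i k, measurable (G i @^-1` [set k])) ->
  (forall i, measurable_fun setT (Z i)) ->
  mutually_independent P G Z ->
  (forall i : 'I_n, has_group_mixture_law P (G (cal i)) (Z (cal i)) p Pi) ->
  has_group_mixture_law P (G ord_max) (Z ord_max) q Pi ->
  (forall k, measurable_fun setT (fun z : X1 * Y => s (k, z.1) z.2)) ->
  ((1 - alpha)%:E - \int[P]_w (max_ratio G q w)%:E <= P (covered G Z s q alpha))%E
  /\
  ((forall k, 8 * ln n%:R / n%:R <= p k) ->
   ((1 - alpha - 4 * n%:R^-1 * \big[Num.max/0]_(k : 'I_K) (q k / p k))%:E
      <= P (covered G Z s q alpha))%E).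
Proof.
move=> _ hp [q0 q1] a01 mG mZ indep lawP lawQ ms; split.
  exact: (coverage_ge mG mZ indep lawP lawQ ms q0 q1 a01).
by move=> pn; exact: (coverage_ge_rate mG mZ indep lawP lawQ ms q0 q1 a01 hp pn).
Qed.
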